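(* Let $CC$ be a C-system and $n\ge 0$. Then the family of functions, parametrized by $\Gamma\in Ob(CC)$, $$S\mathcal{O}b_{n,\Gamma}: Sig(\mathcal{O}b_n)(\Gamma)\to \mathcal{O}b_{n+1}(\Gamma),\qquad (T,X)\mapsto X,$$ is well defined and is an isomorphism of presheaves $S\mathcal{O}b_n: Sig(\mathcal{O}b_n)\to\mathcal{O}b_{n+1}$ on $CC$.
   Context: Conventions. Composition is written in diagrammatic order: for $f:X\to Y$, $g:Y\to Z$ the composite is $f\circ g:X\to Z$. $\amalg_{i\in I}A_i$ denotes the set of pairs $(i,a)$ with $i\in I$, $a\in A_i$. C-systems. A C-system (contextual category) $CC$ is a category with: a length function $l:Ob(CC)\to\mathbb N$; an object $pt$; a function $ft:Ob(CC)\to Ob(CC)$; for each object $X$ a morphism $p_X:X\to ft(X)$; and for each $X$ with $l(X)>0$ and each $f:Y\to ft(X)$ an object $f^*(X)$ and a morphism $q(f,X):f^*(X)\to X$; such that: $l^{-1}(0)=\{pt\}$; $l(ft(X))=l(X)-1$ if $l(X)>0$; $ft(pt)=pt$; $pt$ is final; for $l(X)>0$ and $f:Y\to ft(X)$ one has $l(f^*(X))>0$, $ft(f^*(X))=Y$, $p_{f^*(X)}\circ f=q(f,X)\circ p_X$ and this square is a pullback; $Id_{ft(X)}^*(X)=X$, $q(Id_{ft(X)},X)=Id_X$; and for $g:Z\to Y$, $f:Y\to ft(X)$, $(g\circ f)^*(X)=g^*(f^*(X))$ and $q(g\circ f,X)=q(g,f^*(X))\circ q(f,X)$. The presheaf $\mathcal{O}b_n$.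 For $\Gamma\in CC$, $\mathcal{O}b_n(\Gamma)=\{T\in Ob(CC)\mid l(T)=l(\Gamma)+n,\ ft^n(T)=\Gamma\}$. For $f:\Gamma'\to\Gamma$ and $T\in\mathcal{O}b_n(\Gamma)$ define recursively in $n$ an object $f^*(T)$ and a morphism $q(f,T):f^*(T)\to T$: for $n=0$, $f^*(T)=\Gamma'$ and $q(f,T)=f$; for $n\geq 1$, $f^*(T)=q(f,ft(T))^*(T)$ and $q(f,T)=q(q(f,ft(T)),T)$. Then $\mathcal{O}b_n$ is a presheaf with $\mathcal{O}b_n(f)(T)=f^*(T)$. The functor $Sig$. For a presheaf $\mathcal G$ on $CC$, $Sig(\mathcal G)$ is the presheaf with $Sig(\mathcal G)(\Gamma)=\amalg_{T\in\mathcal{O}b_1(\Gamma)}\mathcal G(T)$ and, for $f:\Gamma'\to\Gamma$, $Sig(\mathcal G)(f)(T,g)=(f^*(T),\mathcal G(q(f,T))(g))$. On a morphism $r:\mathcal G\to\mathcal G'$, $Sig(r)_\Gamma(T,g)=(T,r_T(g))$. *)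

(* Defs.v *)
From mathcomp Require Import all_boot.
From Stdlib Require Import ProofIrrelevance.

Set Implicit Arguments.
Unset Strict Implicit.
Unset Printing Implicit Defensive.

Declare Scope cat_scope.
Delimit Scope cat_scope with cat.
Local Open Scope cat_scope.

Record category := Category {
  obj :> Type;
  hom : obj -> obj -> Type;
  idm : forall X, hom X X;
  (* diagrammatic order: first f : X -> Y, then g : Y -> Z *)
  comp : forall X Y Z, hom X Y -> hom Y Z -> hom X Z;
  comp1m : forall X Y (f : hom X Y), comp (idm X) f = f;
  compm1 : forall X Y (f : hom X Y), comp f (idm Y) = f;
  compA : forall W X Y Z (f : hom W X) (g : hom X Y) (h : hom Y Z),
    comp f (comp g h) = comp (comp f g) h
}.
Arguments idm {c} X.
Notation "f \; g" := (comp f g) : cat_scope.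

Definition cast_cod (C : category) (X Y Y' : C) (e : Y = Y') (f : hom X Y) :
    hom X Y' :=
  eq_rect Y (hom X) f Y' e.

Lemma cast_cod_id (C : category) (X Y : C) (e : Y = Y) (f : hom X Y) :
  cast_cod e f = f.
Proof. by rewrite (proof_irrelevance _ e erefl). Qed.

Lemma cast_cod_comp (C : category) (W X Y Y' : C) (e : Y = Y')
    (g : hom W X) (f : hom X Y) :
  cast_cod e (g \; f) = g \; cast_cod e f.
Proof. by case: _ / e. Qed.

Definition is_final (C : category) (Z : C) : Prop :=
  forall X, exists f : hom X Z, forall g : hom X Z, g = f.

(*      a
    P -----> X
    |        |
   b|        |c
    v        v
    Y -----> Z
        f           *)
Definition is_pullback (C : category) (P X Y Z : C)
    (a : hom P X) (b : hom P Y) (c : hom X Z) (f : hom Y Z) : Prop :=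
  b \; f = a \; c /\
  forall W (a' : hom W X) (b' : hom W Y), b' \; f = a' \; c ->
    exists! u : hom W P, u \; a = a' /\ u \; b = b'.

(* [pb hX f] is f^*(X) and [q hX f] is q(f, X).  Since the codomain of
   p_{f^*(X)} is only propositionally equal to Y, it is transported along
   [ft_pb].  The equations for f^*(X) and q(f, X) under identities and
   composition are stated jointly, as equalities of pairs (A, A -> X): the
   second equation of each pair is only well typed modulo the first. *)
Record csystem := CSystem {
  ccat :> category;
  len : ccat -> nat;
  pt : ccat;
  ft : ccat -> ccat;
  p : forall X, hom X (ft X);
  pb : forall X, 0 < len X -> forall Y, hom Y (ft X) -> ccat;
  q : forall X (hX : 0 < len X) Y (f : hom Y (ft X)), hom (pb hX f) X;
  len_eq0 : forall X, len X = 0 <-> X = pt;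
  len_ft : forall X, 0 < len X -> len (ft X) = len X - 1;
  ft_pt : ft pt = pt;
  pt_final : is_final pt;
  len_pb : forall X (hX : 0 < len X) Y (f : hom Y (ft X)), 0 < len (pb hX f);
  ft_pb : forall X (hX : 0 < len X) Y (f : hom Y (ft X)), ft (pb hX f) = Y;
  pb_pullback : forall X (hX : 0 < len X) Y (f : hom Y (ft X)),
    is_pullback (q hX f) (cast_cod (ft_pb hX f) (p (pb hX f))) (p X) f;
  pb_id : forall X (hX : 0 < len X),
    existT (fun A => hom A X) (pb hX (idm (ft X))) (q hX (idm (ft X)))
    = existT (fun A => hom A X) X (idm X);
  pb_comp : forall X (hX : 0 < len X) Y Z (g : hom Z Y) (f : hom Y (ft X)),
    let g' := cast_cod (esym (ft_pb hX f)) g in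
    existT (fun A => hom A X) (pb hX (g \; f)) (q hX (g \; f))
    = existT (fun A => hom A X)
        (pb (len_pb hX f) g') (q (len_pb hX f) g' \; q hX f)
}.

Record presheaf (C : category) := Presheaf {
  psh_ob :> C -> Type;
  psh_map : forall X Y, hom X Y -> psh_ob Y -> psh_ob X;
  psh_id : forall X (x : psh_ob X), psh_map (idm X) x = x;
  psh_comp : forall X Y Z (f : hom X Y) (g : hom Y Z) (x : psh_ob Z),
    psh_map (f \; g) x = psh_map f (psh_map g x)
}.

Definition natural (C : category) (F G : presheaf C)
    (s : forall X : C, F X -> G X) : Prop :=
  forall X Y (f : hom X Y) (x : F Y), s X (psh_map f x) = psh_map f (s Y x).

Definition presheaf_iso (C : category) (F G : presheaf C)
    (s : forall X : C, F X -> G X) : Prop :=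
  natural s /\
  exists t : forall X : C, G X -> F X,
    natural t /\ forall X, cancel (s X) (t X) /\ cancel (t X) (s X).

Section ObPresheaf.
Variable CC : csystem.
Implicit Types (G D : CC) (n : nat).

Definition is_Ob n G (T : CC) : Prop :=
  len T = len G + n /\ iter n (@ft CC) T = G.

Record Ob n G := MkOb { Ob_obj :> CC; Ob_objP : is_Ob n G Ob_obj }.

Lemma Ob_inj n G (T T' : Ob n G) : Ob_obj T = Ob_obj T' -> T = T'.
Proof.
case: T T' => [T hT] [T' hT'] /= e; case: _ / e hT' => hT'.
by rewrite (proof_irrelevance _ hT hT').
Qed.

Lemma Ob_len_gt0 n G (T : Ob n.+1 G) : 0 < len T.
Proof. by case: T => T [/= -> _]; rewrite addnS. Qed.

Lemma is_Ob_ft n G (T : Ob n.+1 G) : is_Ob n G (ft T).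
Proof.
have T_gt0 := Ob_len_gt0 T.
case: T T_gt0 => T [/= lT eT] T_gt0; split; last by rewrite -iterSr.
by rewrite len_ft // lT addnS subn1.
Qed.

Definition Ob_ft n G (T : Ob n.+1 G) : Ob n G := MkOb (is_Ob_ft T).

(* The pair (f^*(T), q(f, T)). *)
Fixpoint Ob_pull D G (f : hom D G) n :
    forall T : Ob n G, {A : CC & hom A T} :=
  match n return forall T : Ob n G, {A : CC & hom A T} with
  | 0 => fun T =>
      existT (fun A => hom A T) D (cast_cod (esym (proj2 (Ob_objP T))) f)
  | m.+1 => fun T =>
      let r := Ob_pull f (Ob_ft T) in
      existT (fun A => hom A T)
        (pb (Ob_len_gt0 T) (projT2 r)) (q (Ob_len_gt0 T) (projT2 r))
  end.

Lemma is_Ob_pull D G (f : hom D G) n (T : Ob n G) :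
  is_Ob n D (projT1 (Ob_pull f T)).
Proof.
elim: n T => [|n IHn] T /=; first by split; rewrite ?addn0.
have [lB eB] := IHn (Ob_ft T).
set r := Ob_pull f (Ob_ft T) in lB eB *.
have l_gt0 := len_pb (Ob_len_gt0 T) (projT2 r).
have := len_ft l_gt0; rewrite ft_pb lB => lP; split.
  by rewrite addnS lP subn1 prednK.
by rewrite iterSr ft_pb.
Qed.

Definition Ob_map n D G (f : hom D G) (T : Ob n G) : Ob n D :=
  MkOb (is_Ob_pull f T).

Definition Ob_q n D G (f : hom D G) (T : Ob n G) : hom (Ob_map f T) T :=
  projT2 (Ob_pull f T).

Lemma Ob_pullE n D G (f : hom D G) (T : Ob n G) :
  existT (fun A => hom A T) (Ob_map f T : CC) (Ob_q f T) = Ob_pull f T.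
Proof. by rewrite /Ob_q /=; case: (Ob_pull f T). Qed.

Lemma Ob_pull_id n G (T : Ob n G) :
  Ob_pull (idm G) T = existT (fun A => hom A T) (T : CC) (idm T).
Proof.
elim: n T => [|n IHn] T /=.
  case: T => T [lT /= eT] /=; case: _ / eT lT => lT.
  by rewrite /= cast_cod_id.
by rewrite IHn /= pb_id.
Qed.

Lemma Ob_q_cast n D G (f : hom D G) (T T' : Ob n G) (e : T = T') :
  existT (fun A => hom A T') (Ob_map f T : CC)
    (cast_cod (congr1 (@Ob_obj n G) e) (Ob_q f T)) = Ob_pull f T'.
Proof. by case: _ / e; rewrite cast_cod_id Ob_pullE. Qed.

Lemma Ob_pull_comp n K D G (g : hom K D) (f : hom D G) (T : Ob n G) :
  Ob_pull (g \; f) T =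
  existT (fun A => hom A T) (Ob_map g (Ob_map f T) : CC)
    (Ob_q g (Ob_map f T) \; Ob_q f T).
Proof.
elim: n T => [|n IHn] T.
  by rewrite /Ob_q /= cast_cod_id cast_cod_comp.
rewrite [LHS]/= IHn /= pb_comp /Ob_q /=.
set r := Ob_pull f (Ob_ft T).
set h := Ob_len_gt0 T.
set T' := MkOb (is_Ob_pull f T).
have e : Ob_map f (Ob_ft T) = Ob_ft T'.
  by apply: Ob_inj; rewrite /= ft_pb.
rewrite -(Ob_q_cast g e) /=.
rewrite (proof_irrelevance _ (Ob_len_gt0 T') (len_pb h (projT2 r))).
by rewrite (proof_irrelevance _ (congr1 (@Ob_obj n D) e)
             (esym (ft_pb h (projT2 r)))).
Qed.

Lemma Ob_map_id n G (T : Ob n G) : Ob_map (idm G) T = T.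
Proof. by apply: Ob_inj; rewrite /= Ob_pull_id. Qed.

Lemma Ob_map_comp n K D G (g : hom K D) (f : hom D G) (T : Ob n G) :
  Ob_map (g \; f) T = Ob_map g (Ob_map f T).
Proof. by apply: Ob_inj; rewrite /= Ob_pull_comp. Qed.

Definition Ob_psh n : presheaf CC :=
  Presheaf (@Ob_map_id n) (@Ob_map_comp n).

Section Sig.
Variable F : presheaf CC.

Definition Sig_ob G : Type := {T : Ob 1 G & F T}.

Definition Sig_map D G (f : hom D G) (x : Sig_ob G) : Sig_ob D :=
  existT (fun T : Ob 1 D => F T)
    (Ob_map f (projT1 x)) (psh_map (Ob_q f (projT1 x)) (projT2 x)).

Lemma Sig_eq D (T T' : Ob 1 D) (G : CC) (a : hom T G) (a' : hom T' G)
    (x : F G) :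
  existT (fun A => hom A G) (T : CC) a = existT (fun A => hom A G) (T' : CC) a'
  -> existT (fun T : Ob 1 D => F T) T (psh_map a x)
     = existT (fun T : Ob 1 D => F T) T' (psh_map a' x).
Proof.
move=> e; have eT : T = T' by apply: Ob_inj; exact: (congr1 (@projT1 _ _) e).
case: _ / eT a' e => a' e.
by rewrite (inj_pairT2 _ _ _ _ _ e).
Qed.

Lemma Sig_map_id G (x : Sig_ob G) : Sig_map (idm G) x = x.
Proof.
case: x => T x; rewrite -[in RHS](psh_id x); apply: Sig_eq.
by rewrite Ob_pullE Ob_pull_id.
Qed.

Lemma Sig_map_comp K D G (g : hom K D) (f : hom D G) (x : Sig_ob G) :
  Sig_map (g \; f) x = Sig_map g (Sig_map f x).
Proof.
case: x => T x; rewrite /Sig_map [in RHS]/= -psh_comp; apply: Sig_eq.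
by rewrite Ob_pullE Ob_pull_comp.
Qed.

Definition Sig : presheaf CC := Presheaf Sig_map_id Sig_map_comp.

End Sig.
End ObPresheaf.

(* Main.v *)
Require Import Defs.
From mathcomp Require Import all_boot.
From Stdlib Require Import ProofIrrelevance.

(** An object X lying n levels above an object T of Ob_1(G) lies n+1 levels
    above G, and T can be recovered from X as ft^n(X).  So forgetting T is a
    bijection, with inverse X |-> (ft^n(X), X) (lemmas [is_Ob_Sig],
    [is_Ob_iter_ft] and [is_Ob_below]).  Naturality says that pulling X back
    along f : D -> G over G is the same as pulling it back over T along
    q(f, T); this is [Ob_pull_Sig].  The recursions that define the two
    pullbacks take the same step at each level above T, and at T itself both
    give (f^*(T), q(f, T)).  The inverse of a natural family of bijections is
    natural, so this gives an isomorphism of presheaves. *)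

Set Implicit Arguments.
Unset Strict Implicit.
Unset Printing Implicit Defensive.

Lemma presheaf_iso_cancel (C : category) (F G : presheaf C)
    (s : forall X : C, F X -> G X) (t : forall X : C, G X -> F X) :
  natural s -> (forall X, cancel (s X) (t X)) ->
  (forall X, cancel (t X) (s X)) -> presheaf_iso s.
Proof.
move=> s_nat sK tK; split=> //; exists t; split=> [X Y f x | X]; last by split.
by rewrite -{1}[x]tK -s_nat sK.
Qed.

Section SigOb.
Variable CC : csystem.
Implicit Types (G D : CC) (n : nat).

Lemma len_iter_ft n (X : CC) : len (iter n (@ft CC) X) = len X - n.
Proof.
elim: n => [|n IHn]; first by rewrite subn0.
rewrite iterS subnS -IHn; set Y := iter n _ X.
case: (posnP (len Y)) => [Y0 | Y_gt0]; last by rewrite len_ft // subn1.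
(* At length 0 truncated subtraction agrees with ft(pt) = pt. *)
by rewrite (proj1 (len_eq0 Y) Y0) ft_pt (proj2 (len_eq0 (pt CC)) erefl).
Qed.

Lemma is_Ob_Sig n G (T : Ob 1 G) (X : Ob n T) : is_Ob n.+1 G X.
Proof.
case: X => X [/= lX eX]; case: T lX eX => T [/= lT eT] /= lX eX.
by split; [rewrite lX lT -addnA | rewrite iterS eX].
Qed.

Lemma is_Ob_iter_ft n G (X : Ob n.+1 G) : is_Ob 1 G (iter n (@ft CC) X).
Proof.
case: X => X [/= lX eX]; split=> //.
by rewrite len_iter_ft lX addnS subSn ?leq_addl // addnK addn1.
Qed.

Lemma is_Ob_below n G (X : Ob n.+1 G) : is_Ob n (iter n (@ft CC) X) X.
Proof.
case: X => X [/= lX eX]; split=> //.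
by rewrite len_iter_ft subnK // lX addnS ltnW // ltnS leq_addl.
Qed.

Definition Sig_to_Ob n G (TX : Sig (Ob_psh CC n) G) : Ob_psh CC n.+1 G :=
  MkOb (is_Ob_Sig (projT2 TX)).

Definition Ob_to_Sig n G (X : Ob_psh CC n.+1 G) : Sig (Ob_psh CC n) G :=
  existT (fun T : Ob 1 G => Ob n T) (MkOb (is_Ob_iter_ft X))
    (MkOb (is_Ob_below X : is_Ob n (MkOb (is_Ob_iter_ft X)) X)).

Lemma Ob_to_SigK n G : cancel (@Ob_to_Sig n G) (@Sig_to_Ob n G).
Proof. by move=> X; apply: Ob_inj. Qed.

(** The condition ft^n(X) = T makes T a function of X. *)
Lemma Sig_to_Ob_inj n G : injective (@Sig_to_Ob n G).
Proof.
move=> [T X] [T' X'] /(congr1 (@Ob_obj _ _ _)) /= eX.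
have eT : T = T'.
  apply: Ob_inj.
  by rewrite -(proj2 (Ob_objP X)) -(proj2 (Ob_objP X')) eX.
by case: _ / eT X' eX => X' eX; congr existT; apply: Ob_inj.
Qed.

Lemma Sig_to_ObK n G : cancel (@Sig_to_Ob n G) (@Ob_to_Sig n G).
Proof. by move=> TX; apply: Sig_to_Ob_inj; rewrite Ob_to_SigK. Qed.

(** Both sides iterate q(-, -) up the tower from T to X.  Equality is stated
    for pairs, object and projection together, since each step of the
    recursion needs the projection of the step below. *)
Lemma Ob_pull_Sig n D G (f : hom D G) (T : Ob 1 G) (X : Ob n T) :
  Ob_pull f (MkOb (is_Ob_Sig X)) = Ob_pull (Ob_q f T) X.
Proof.
elim: n X => [|n IHn] X.
  (* Here X = T as objects, and the right-hand side is (f^*(T), q(f, T)) with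
     the codomain of q(f, T) transported to X. *)
  have e : T = MkOb (is_Ob_Sig X).
    by apply: Ob_inj; exact: esym (proj2 (Ob_objP X)).
  rewrite -(Ob_q_cast f e) [RHS]/=.
  by rewrite (proof_irrelevance _ (congr1 _ e) (esym (proj2 (Ob_objP X)))).
rewrite [RHS]/= -IHn /= /Ob_ft.
rewrite (proof_irrelevance _ (is_Ob_ft (MkOb (is_Ob_Sig X)))
  (is_Ob_Sig (Ob_ft X))).
by rewrite (proof_irrelevance _ (Ob_len_gt0 (MkOb (is_Ob_Sig X)))
  (Ob_len_gt0 X)).
Qed.

Lemma Sig_to_Ob_natural n : natural (@Sig_to_Ob n).
Proof.
move=> D G f [T X]; apply: Ob_inj.
exact: esym (congr1 (@projT1 _ _) (Ob_pull_Sig f X)).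
Qed.

End SigOb.

Theorem mainTheorem1 (CC : csystem) (n : nat) :
  exists wd : forall (G : CC) (T : Ob 1 G) (X : Ob n T), is_Ob n.+1 G X,
    presheaf_iso (F := Sig (Ob_psh CC n)) (G := Ob_psh CC n.+1)
      (fun (G : CC) (TX : Sig (Ob_psh CC n) G) =>
         MkOb (wd G (projT1 TX) (projT2 TX))).
Proof.
exists (@is_Ob_Sig CC n).
exact: presheaf_iso_cancel (@Sig_to_Ob_natural CC n) (@Sig_to_ObK CC n)
  (@Ob_to_SigK CC n).
Qed.
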